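(* Consider the Lagrange--Poincaré reduced equations of the 3D pendulum on $S^2\times\mathbb{R}^3$ $$J\dot\omega=J\omega\times\omega+mg\,\rho\times\Gamma,\qquad \dot\Gamma=\Gamma\times\omega,$$ and their linearization at the hanging equilibrium $(\Gamma,\omega)=(\Gamma_h,0)$, $\Gamma_h=\rho/\|\rho\|$, with perturbation variables $(\Delta\Gamma,\Delta\omega)\in T_{\Gamma_h}S^2\times\mathbb{R}^3$. This linearization can be expressed in terms of the variables $(x_1,x_2,\dot x_1,\dot x_2,\dot x_3)\in\mathbb{R}^5$ (with $x=(x_1,x_2,x_3)$ related to the perturbations by $\Delta\omega=M^{-T}\dot x$ and $\Delta\Gamma=\widehat{\Gamma}_hM^{-T}x$) according to $$\ddot x_1+mgl_1x_1=0,\qquad \ddot x_2+mgl_2x_2=0,\qquad \ddot x_3=0.$$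
   Context: $\Gamma=R^Te_3\in S^2$ is the gravity direction in the body frame ($R\in SO(3)$ the attitude, $e_3=(0,0,1)^T$), $\omega\in\mathbb{R}^3$ the body-fixed angular velocity, $J$ the symmetric positive definite inertia matrix, $m>0$ the mass, $g>0$ gravity, $\rho\neq0$ the body-fixed vector from the pivot to the center of mass. For $a\in\mathbb{R}^3$, $\widehat a$ is the skew-symmetric matrix with $\widehat a\,b=a\times b$. $M$ is a nonsingular $3\times3$ matrix simultaneously diagonalizing $J$ and $\widehat\rho^{\,2}$: $J=MM^T$ and $-\frac{mg}{\|\rho\|}\widehat\rho^{\,2}=M\Lambda M^T$ with $\Lambda=\mathrm{diag}(mgl_1,mgl_2,0)$, $l_1,l_2>0$ (such $M$ exists since $J$ is positive definite and $-\widehat\rho^{\,2}$ is positive semidefinite of rank 2). For the full model, attitude perturbations $\Delta\Theta\in\mathbb{R}^3$ about an equilibrium attitude $R_{\rm e}$ with $R_{\rm e}^Te_3=\Gamma_h$ (first-order perturbation of $R$ equal to $R_{\rm e}\widehat{\Delta\Theta}$) satisfy $\Delta\omega=\Delta\dot\Theta$ and $\Delta\Gamma=\widehat\Gamma_h\Delta\Theta$, and $x:=M^T\Delta\Theta$. *)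

(* Defs.v *)
From mathcomp Require Import all_boot all_order all_algebra.
From mathcomp Require Import all_classical all_reals all_analysis.
From mathcomp Require Import ring.

Set Implicit Arguments.
Unset Strict Implicit.
Unset Printing Implicit Defensive.

Import Order.TTheory GRing.Theory Num.Theory.
Import numFieldNormedType.Exports.

Local Open Scope classical_set_scope.
Local Open Scope ring_scope.

Definition col3 (R : realType) (a b c : R) : 'cV[R]_3 :=
  \col_(i < 3) [:: a; b; c]`_i.

Definition dot (R : realType) (u v : 'cV[R]_3) : R := (u^T *m v) 0 0.

(* The canonical norm `|u| of a matrix is the sup norm, hence this one. *)
Definition enorm (R : realType) (u : 'cV[R]_3) : R := Num.sqrt (dot u u).

Definition cross (R : realType) (u v : 'cV[R]_3) : 'cV[R]_3 :=
  col3 (u 1 0 * v 2%R 0 - u 2%R 0 * v 1 0)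
       (u 2%R 0 * v 0 0 - u 0 0 * v 2%R 0)
       (u 0 0 * v 1 0 - u 1 0 * v 0 0).

Definition hat (R : realType) (a : 'cV[R]_3) : 'M[R]_3 :=
  \matrix_(i < 3, j < 3)
    nth 0 (nth [::] [:: [:: 0; - a 2%R 0; a 1 0];
                        [:: a 2%R 0; 0; - a 0 0];
                        [:: - a 1 0; a 0 0; 0]] i) j.

Lemma hat_mul (R : realType) (a b : 'cV[R]_3) : hat a *m b = cross a b.
Proof.
have E0 : ord0 = 0 :> 'I_3 by apply: val_inj.
have E1 : lift ord0 ord0 = 1 :> 'I_3 by apply: val_inj.
have E2 : lift ord0 (lift ord0 ord0) = 2%R :> 'I_3 by apply: val_inj.
apply/colP => i; rewrite mxE !big_ord_recl big_ord0 !mxE E0 E1 E2.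
by case: i => [[|[|[|//]]]] ? /=; ring.
Qed.

Definition sym_posdef (R : realType) (J : 'M[R]_3) : Prop :=
  J^T = J /\ forall v : 'cV[R]_3, v != 0 -> 0 < dot v (J *m v).

(* States and perturbations are pairs (Gamma, omega), resp.
   (DeltaGamma, DeltaOmega). *)
Notation state R := ('cV[R]_3 * 'cV[R]_3)%type.

Definition reduced_space (R : realType) : set (state R) :=
  [set z | enorm z.1 = 1].

Definition reduced_tangent (R : realType) (z : state R) : set (state R) :=
  [set d | dot z.1 d.1 = 0].

(* The reduced equations solved for (Gamma', omega'), see reduced_fieldP.
   The formula makes sense on the whole of R^3 x R^3 and is tangent to
   S^2 x R^3 along it (reduced_field_tangent), so that the linearization on
   S^2 x R^3 at an equilibrium is the differential of this ambient field
   restricted to the tangent space. *)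
Definition reduced_field (R : realType) (J : 'M[R]_3) (m g : R)
    (rho : 'cV[R]_3) (z : state R) : state R :=
  (cross z.1 z.2,
   invmx J *m (cross (J *m z.2) z.2 + (m * g) *: cross rho z.1)).

Lemma reduced_fieldP (R : realType) (J : 'M[R]_3) (m g : R)
    (rho Gamma omega dGamma domega : 'cV[R]_3) : J \in unitmx ->
  (dGamma, domega) = reduced_field J m g rho (Gamma, omega) <->
  J *m domega = cross (J *m omega) omega + (m * g) *: cross rho Gamma /\
  dGamma = cross Gamma omega.
Proof.
move=> uJ; rewrite /reduced_field /=; split=> [[-> ->]|[<- ->]].
  by rewrite mulKVmx.
by rewrite mulKmx.
Qed.

Lemma reduced_field_tangent (R : realType) (J : 'M[R]_3) (m g : R)
    (rho : 'cV[R]_3) (z : state R) :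
  reduced_tangent z (reduced_field J m g rho z).
Proof.
have E0 : ord0 = 0 :> 'I_3 by apply: val_inj.
have E1 : lift ord0 ord0 = 1 :> 'I_3 by apply: val_inj.
have E2 : lift ord0 (lift ord0 ord0) = 2%R :> 'I_3 by apply: val_inj.
rewrite /reduced_tangent /dot /= mxE !big_ord_recl big_ord0 !mxE E0 E1 E2 /=.
by ring.
Qed.

Definition linearized_solution (R : realType) (F : state R -> state R)
    (z0 : state R) (I : set R) (delta : R -> state R) : Prop :=
  forall t, I t ->
    reduced_tangent z0 (delta t) /\
    is_derive t (1 : R) delta ('d F z0 (delta t)).

Definition hanging_dir (R : realType) (rho : 'cV[R]_3) : 'cV[R]_3 :=
  (enorm rho)^-1 *: rho.

Definition hanging_equilibrium (R : realType) (rho : 'cV[R]_3) : state R :=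
  (hanging_dir rho, 0).

(* (DeltaGamma, DeltaOmega) in terms of x and its velocity v. *)
Definition perturbation (R : realType) (M : 'M[R]_3) (rho x v : 'cV[R]_3) :
    state R :=
  (hat (hanging_dir rho) *m invmx M^T *m x, invmx M^T *m v).

Definition reduced_coord (R : realType) (x v : 'cV[R]_3) : 'rV[R]_5 :=
  \row_(i < 5) [:: x 0 0; x 1 0; v 0 0; v 1 0; v 2%R 0]`_i.

Definition twice_derivable_on (R : realType) (I : set R)
    (x : R -> 'cV[R]_3) : Prop :=
  forall t, I t -> derivable x t 1 /\ derivable (derive1 x) t 1.

(* Main.v *)
(* With G = rho / |rho| and N = M^-T, the differential of the reduced field at
   the hanging equilibrium is (dG, dw) |-> (G x dw, J^-1 (m g rho x dG)), every
   term quadratic in the perturbation being lost.  On (G x N x, N v) its second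
   component is (m g / |rho|) J^-1 hat(rho)^2 N x = - N Lambda x, by the
   simultaneous diagonalization and J^-1 = N M^-1, so the linearized equations
   reduce to x'' = - Lambda x.
   Since Lambda has kernel spanned by e_3, x |-> G x N x kills exactly the third
   coordinate, whence the coordinates (x1, x2, v1, v2, v3) on the tangent space.
   Conversely a solution determines x1, x2 and v, and v3' = 0 makes v3 constant
   on the interval, so that x3 = t v3 is an admissible third coordinate. *)
From HB Require Import structures.
Require Import Defs.
From mathcomp Require Import all_boot all_order all_algebra.
From mathcomp Require Import all_classical all_reals all_analysis.
From mathcomp Require Import ring.

Set Implicit Arguments.
Unset Strict Implicit.
Unset Printing Implicit Defensive.

Import Order.TTheory GRing.Theory Num.Theory.
Import numFieldNormedType.Exports.

Local Open Scope classical_set_scope.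
Local Open Scope ring_scope.

(** * Calculus of linear maps, pairs and matrix products *)

Lemma is_diff_linear (R : numFieldType) (V W : normedModType R) (f : V -> W)
  (x : V) : linear f -> continuous f -> is_diff x f f.
Proof.
(* The propositional hypothesis is packed into a linear map structure so that the differential of a
   continuous linear map applies. *)
move=> lf cf; pose fM := GRing.isLinear.Build _ _ _ _ _ lf.
pose fL : {linear V -> W} := HB.pack f fM.
apply: DiffDef; first exact: (@linear_differentiable _ _ _ fL).
exact: (@diff_lin _ _ _ fL).
Qed.

Lemma is_derive1_linear (R : numFieldType) (V W : normedModType R)
  (L : V -> W) (f : R -> V) (t : R) (df : V) :
  linear L -> continuous L -> is_derive t (1 : R) f df ->
  is_derive t (1 : R) (fun s => L (f s)) (L df).
Proof.
move=> lL cL [/derivable1_diffP df1 <-].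
have dL := is_diff_linear (f t) lL cL.
have dLf : differentiable (L \o f) t by exact: differentiable_comp.
apply: DeriveDef; first exact/derivable1_diffP.
by rewrite deriveE// diff_comp//= diff_val deriveE.
Qed.

Lemma is_derive1_pair (R : numFieldType) (V W : normedModType R)
  (f : R -> V) (g : R -> W) (t : R) (df : V) (dg : W) :
  is_derive t (1 : R) f df -> is_derive t (1 : R) g dg ->
  is_derive t (1 : R) (fun s => (f s, g s)) (df, dg).
Proof.
move=> [/derivable1_diffP df1 <-] [/derivable1_diffP dg1 <-].
apply: DeriveDef; first exact/derivable1_diffP/differentiable_pair.
by rewrite deriveE ?diff_pair ?deriveE//; exact: differentiable_pair.
Qed.

Lemma is_derive1_pairP (R : numFieldType) (V W : normedModType R)
  (f : R -> V * W) (t : R) (d : V * W) :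
  is_derive t (1 : R) f d <->
  is_derive t (1 : R) (fun s => (f s).1) d.1 /\
  is_derive t (1 : R) (fun s => (f s).2) d.2.
Proof.
split=> [fd|[f1 f2]].
  split; apply: (is_derive1_linear _ _ fd) => //.
  - by move=> ?; exact: cvg_fst.
  - by move=> ?; exact: cvg_snd.
have -> : f = (fun s => ((f s).1, (f s).2)) by apply/funext => s; case: (f s).
by rewrite (surjective_pairing d); exact: is_derive1_pair.
Qed.

Lemma is_derive1_uniq (R : numFieldType) (V : normedModType R)
  (f : R -> V) (t : R) (a b : V) :
  is_derive t (1 : R) f a -> is_derive t (1 : R) f b -> a = b.
Proof. by move=> [_ <-] [_ <-]. Qed.

(** In finite dimension, expanding along the matrix units makes [f] a finite sum of coordinates
    times fixed vectors, each continuous. *)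
Lemma linear_mx_continuous (R : numFieldType) (W : normedModType R) (m n : nat)
  (f : 'M[R]_(m, n) -> W) : linear f -> continuous f.
Proof.
move=> lf; pose fM := GRing.isLinear.Build _ _ _ _ _ lf.
pose fL : {linear 'M[R]_(m, n) -> W} := HB.pack f fM.
have -> : f = fun A => \sum_i \sum_j A i j *: f (delta_mx i j).
  apply/funext => A; rewrite {1}[A]matrix_sum_delta -[f]/(fL : _ -> _).
  rewrite linear_sum; apply: eq_bigr => i _.
  by rewrite linear_sum; apply: eq_bigr => j _; rewrite linearZ.
apply: continuous_big => [|i _]; first exact: add_continuous.
apply: continuous_big => [|j _]; first exact: add_continuous.
by move=> A; apply: continuousZr_tmp; exact: coord_continuous.
Qed.

Lemma mulmx_linear (R : numFieldType) n p q (A : 'M[R]_(n, p)) :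
  linear (mulmx A : 'M[R]_(p, q) -> _).
Proof. by move=> k u v; rewrite mulmxDr scalemxAr. Qed.

Lemma is_derive1_mulmx (R : numFieldType) n p q (A : 'M[R]_(n, p))
  (f : R -> 'M[R]_(p, q)) t df :
  is_derive t (1 : R) f df -> is_derive t (1 : R) (fun s => A *m f s) (A *m df).
Proof.
exact: is_derive1_linear (mulmx_linear A)
  (linear_mx_continuous (mulmx_linear A)).
Qed.

(** * Bilinearity of the cross product and differential of the reduced field *)

Section Cross.
Context {R : realType}.
Implicit Types (u v w : 'cV[R]_3) (k : R).

Lemma cross_linearr u : linear (cross u).
Proof. by move=> k v w; rewrite -!hat_mul mulmxDr scalemxAr. Qed.

Lemma crossC u v : cross u v = - cross v u.
Proof.
by apply/colP => -[[|[|[|//]]] ?]; rewrite !mxE /=; ring.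
Qed.

Lemma cross_linearl v : linear (fun u => cross u v).
Proof.
by move=> k u w; rewrite !(crossC _ v) cross_linearr scalerN opprD.
Qed.

Lemma cross_bilinear :
  bilinear_for
    (GRing.Scale.Law.clone _ _ *:%R _) (GRing.Scale.Law.clone _ _ *:%R _)
    (@cross R).
Proof. by split=> w k u v; [exact: cross_linearl|exact: cross_linearr]. Qed.

HB.instance Definition _ :=
  bilinear_isBilinear.Build R _ _ _ _ _ (@cross R) cross_bilinear.

(** Joint continuity is what the differentiation rule for bilinear maps asks for. Expanding the
    second argument alone leaves coordinates of it times linear maps of the first. *)
Lemma cross_continuous :
  continuous (fun p : 'cV[R]_3 * 'cV[R]_3 => cross p.1 p.2).
Proof.
have -> : (fun p : 'cV[R]_3 * 'cV[R]_3 => cross p.1 p.2) =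
    fun p => \sum_(j < 3) p.2 j 0 *: cross p.1 (delta_mx j 0).
  apply/funext => p; rewrite {1}[p.2]matrix_sum_delta linear_sumr.
  by apply: eq_bigr => i _; rewrite big_ord1 linearZr.
apply: continuous_big => [|i _]; first exact: add_continuous.
move=> p; apply: (continuousZ (s := fun p : state R => p.2 i 0)
  (f := fun p : state R => cross p.1 _)).
  by apply: (continuous_comp (f := snd) (g := fun v : 'cV[R]_3 => v i 0));
    [exact: cvg_snd|exact: coord_continuous].
apply: (continuous_comp (f := fst) (g := fun u => cross u _)).
  exact: cvg_fst.
by apply: linear_mx_continuous; exact: cross_linearl.
Qed.

Lemma is_derive1_cross u (f : R -> 'cV[R]_3) t df :
  is_derive t (1 : R) f df ->
  is_derive t (1 : R) (fun s => cross u (f s)) (cross u df).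
Proof.
exact: is_derive1_linear (cross_linearr u)
  (linear_mx_continuous (cross_linearr u)).
Qed.

Lemma is_diff_cross (V : normedModType R) (f g df dg : V -> 'cV[R]_3) (x : V) :
  is_diff x f df -> is_diff x g dg ->
  is_diff x (fun y => cross (f y) (g y))
    (fun h => cross (f x) (dg h) + cross (df h) (g x)).
Proof.
move=> fd gd.
have cd : is_diff (f x, g x) (fun p : 'cV[R]_3 * 'cV[R]_3 => cross p.1 p.2)
    (fun q => cross (f x) q.2 + cross q.1 (g x)).
  apply: DiffDef; first exact/differentiable_bilin/cross_continuous.
  exact/diff_bilin/cross_continuous.
exact: (is_diff_comp (f := fun y => (f y, g y))).
Qed.

Lemma is_diff_mulmx (V : normedModType R) m n p (A : 'M[R]_(m, n))
  (f df : V -> 'M[R]_(n, p)) (x : V) :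
  is_diff x f df -> is_diff x (fun y => A *m f y) (fun h => A *m df h).
Proof.
move=> fd; have lA := @mulmx_linear R _ _ p A.
have Ad := is_diff_linear (f x) lA (linear_mx_continuous lA).
exact: is_diff_comp.
Qed.

Lemma is_diff_reduced_field (J : 'M[R]_3) m g rho (z : state R) :
  is_diff z (reduced_field J m g rho) (fun d =>
    (cross z.1 d.2 + cross d.1 z.2,
     invmx J *m (cross (J *m z.2) d.2 + cross (J *m d.2) z.2
                 + (m * g) *: cross rho d.1))).
Proof.
have d1 : is_diff z (fst : state R -> _) fst.
  by apply: is_diff_linear => // ?; exact: cvg_fst.
have d2 : is_diff z (snd : state R -> _) snd.
  by apply: is_diff_linear => // ?; exact: cvg_snd.
apply: is_diff_pair; first exact: is_diff_cross.
apply: is_diff_mulmx; apply: is_diffD.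
  by apply: is_diff_cross => //; exact: is_diff_mulmx.
have lr : linear (fun u => (m * g) *: cross rho u).
  move=> k u v; rewrite cross_linearr scalerDr !scalerA.
  by rewrite [in LHS](mulrC _ k).
have rd := is_diff_linear z.1 lr (linear_mx_continuous lr).
exact: (is_diff_comp d1 rd).
Qed.

End Cross.

(** Mean value theorem on the segment between the two points, which lies in [I] because [I] is an
    interval. *)
Lemma derive0_interval_cst (R : realType) (I : set R) (f : R -> R) :
  is_interval I -> (forall t, I t -> is_derive t (1 : R) f 0) ->
  forall s t, I s -> I t -> f s = f t.
Proof.
move=> itvI fd s t; wlog st : s t / s <= t => [hw Is It|Is It].
  by case: (leP s t) => [|/ltW] ?; [|symmetry]; exact: hw.
have Iu u : u \in `[s, t] -> I u by rewrite in_itv /=; exact: itvI.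
have [||u _] := @MVT_segment _ f (fun=> 0) _ _ st.
- by move=> u /subset_itv_oo_cc/Iu/fd.
- by apply: derivable_within_continuous => u /Iu/fd [].
by rewrite mul0r => /subr0_eq.
Qed.

(** * Algebra of dot and cross products, and of the hanging direction *)

Section Cross3.
Context {R : realType}.
Implicit Types (u v w x : 'cV[R]_3) (k : R).

Lemma cV3P u v :
  [/\ u 0 0 = v 0 0, u 1 0 = v 1 0 & u 2%R 0 = v 2%R 0] <-> u = v.
Proof.
split=> [[e0 e1 e2]|->//]; apply/colP => -[[|[|[|//]]] i].
- by move: e0; congr (u _ _ = v _ _); exact: val_inj.
- by move: e1; congr (u _ _ = v _ _); exact: val_inj.
- by move: e2; congr (u _ _ = v _ _); exact: val_inj.
Qed.

Lemma dotE u v : dot u v = u 0 0 * v 0 0 + u 1 0 * v 1 0 + u 2%R 0 * v 2%R 0.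
Proof.
rewrite /dot mxE !big_ord_recl big_ord0 !mxE addr0 addrA.
by congr (u _ _ * v _ _ + u _ _ * v _ _ + u _ _ * v _ _); exact: val_inj.
Qed.

Lemma dot_cross u v : dot u (cross u v) = 0.
Proof. by rewrite dotE !mxE /=; ring. Qed.

Lemma dotZ k l u v : dot (k *: u) (l *: v) = k * l * dot u v.
Proof. by rewrite !dotE !mxE; ring. Qed.

Lemma cross_cross u v : cross u (cross u v) = dot u v *: u - dot u u *: v.
Proof. by apply/cV3P; rewrite !dotE !mxE /=; split; ring. Qed.

Lemma crossZl k u v : cross (k *: u) v = k *: cross u v.
Proof. by apply/cV3P; rewrite !mxE /=; split; ring. Qed.

Lemma crossZr k u v : cross u (k *: v) = k *: cross u v.
Proof. by apply/cV3P; rewrite !mxE /=; split; ring. Qed.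

Lemma crossNr u v : cross u (- v) = - cross u v.
Proof. by rewrite -scaleN1r crossZr scaleN1r. Qed.

Lemma crossBr u v w : cross u (v - w) = cross u v - cross u w.
Proof. by apply/cV3P; rewrite !mxE /=; split; ring. Qed.

Lemma dot_gt0 u : u != 0 -> 0 < dot u u.
Proof.
move=> u0; rewrite dotE lt_neqAle !addr_ge0 ?sqr_ge0//= ?andbT; last first.
all: rewrite -?expr2 ?sqr_ge0//.
apply: contra u0; rewrite eq_sym !paddr_eq0 ?addr_ge0 ?sqr_ge0// !sqrf_eq0.
by move=> /andP[/andP[/eqP ? /eqP ?] /eqP ?]; apply/eqP/cV3P; rewrite !mxE.
Qed.

Lemma enorm_gt0 u : u != 0 -> 0 < enorm u.
Proof. by move=> /dot_gt0; rewrite sqrtr_gt0. Qed.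

Lemma dot_hanging u : u != 0 -> dot (hanging_dir u) (hanging_dir u) = 1.
Proof.
move=> u0; rewrite dotZ -invfM -expr2 sqr_sqrtr ?(ltW (dot_gt0 u0))//.
by rewrite mulVf// gt_eqF// dot_gt0.
Qed.

(** On the plane orthogonal to a unit vector, the cross product with it is a quarter turn, whose
    square is minus the identity. This is how an attitude perturbation is recovered from a
    perturbation of the gravity direction. *)
Lemma cross_hangingK u v : u != 0 -> dot (hanging_dir u) v = 0 ->
  cross (hanging_dir u) (cross (hanging_dir u) v) = - v.
Proof.
by move=> u0 uv; rewrite cross_cross uv dot_hanging// scale0r sub0r scale1r.
Qed.

Lemma enorm_hanging u : u != 0 -> enorm u *: hanging_dir u = u.
Proof.
by move=> u0; rewrite scalerA divff ?scale1r// gt_eqF// enorm_gt0.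
Qed.

End Cross3.

Definition diag3_mul (R : realType) (k1 k2 : R) (x : 'cV[R]_3) : 'cV[R]_3 :=
  col3 (k1 * x 0 0) (k2 * x 1 0) 0.

(** * The linearization in the coordinates that diagonalize inertia and gravity *)

Section Pendulum.
Context {R : realType} (J M : 'M[R]_3) (m g l1 l2 : R) (rho : 'cV[R]_3).
Hypotheses (m_gt0 : 0 < m) (g_gt0 : 0 < g) (rho_neq0 : rho != 0).
Hypotheses (l1_gt0 : 0 < l1) (l2_gt0 : 0 < l2).
Hypotheses (M_unit : M \in unitmx) (J_diag : J = M *m M^T).
Hypothesis rho_diag : - (m * g / enorm rho) *: (hat rho *m hat rho) =
  M *m diag_mx (col3 (m * g * l1) (m * g * l2) 0)^T *m M^T.

Local Notation F := (reduced_field J m g rho).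
Local Notation z0 := (hanging_equilibrium rho).
Local Notation G := (hanging_dir rho).
Local Notation N := (invmx M^T).
Implicit Types x v w : 'cV[R]_3.

Let MT_unit : M^T \in unitmx. Proof. by rewrite unitmx_tr. Qed.

Local Notation stiffness := (diag3_mul (m * g * l1) (m * g * l2)).

Lemma diag_mx_stiffness x :
  diag_mx (col3 (m * g * l1) (m * g * l2) 0)^T *m x = stiffness x.
Proof.
by apply/cV3P; rewrite mul_diag_mx !mxE /= mul0r.
Qed.

Lemma perturbationE x v : perturbation M rho x v = (cross G (N *m x), N *m v).
Proof. by rewrite /perturbation -mulmxA hat_mul. Qed.

Lemma restoring_torque x :
  (m * g) *: cross rho (cross G (N *m x)) = - (M *m stiffness x).
Proof.
have := congr1 (mulmx^~ (N *m x)) rho_diag.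
rewrite -!mulmxA mulKVmx// diag_mx_stiffness => <-.
by rewrite -scalemxAl -mulmxA !hat_mul scaleNr opprK crossZl crossZr scalerA.
Qed.

Lemma invJ_restoring_torque x :
  invmx J *m ((m * g) *: cross rho (cross G (N *m x))) = - (N *m stiffness x).
Proof.
have -> : invmx J = N *m invmx M.
  have uJ : J \in unitmx by rewrite J_diag unitmx_mul M_unit.
  rewrite -[RHS](mulmxK uJ) J_diag !mulmxA -(mulmxA N) mulVmx// mulmx1.
  by rewrite mulVmx// mul1mx.
by rewrite restoring_torque mulmxN -mulmxA mulKmx.
Qed.

(** The restoring torque links both sides. If the cross product vanishes, so does the torque, hence
    [stiffness x], whose first two coefficients are nonzero. Conversely, zero stiffness kills the
    torque, hence a second cross product with [G], which is injective on the plane orthogonal to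
    [G]. *)
Lemma cross_hanging_eq0 x : cross G (N *m x) = 0 <-> x 0 0 = 0 /\ x 1 0 = 0.
Proof.
split=> [x0|[x0 x1]].
  have: stiffness x = 0.
    apply: (can_inj (mulKmx M_unit)); apply: oppr_inj.
    by rewrite -restoring_torque x0 mulmx0 oppr0 -hat_mul mulmx0 scaler0.
  have mgl (l : R) : 0 < l -> m * g * l != 0.
    by move=> ?; rewrite gt_eqF// !mulr_gt0.
  move=> /cV3P; rewrite !mxE/= => -[/eqP + /eqP + _].
  rewrite !(mulf_eq0 (m * g * _)) (negbTE (mgl _ l1_gt0)).
  by rewrite (negbTE (mgl _ l2_gt0)) => /eqP ? /eqP.
have Sx : stiffness x = 0 by apply/cV3P; rewrite !mxE/= x0 x1 !mulr0.
have GG : cross G (cross G (N *m x)) = 0.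
  (* This factor turns the outer [G] into [rho] times [m * g], so that the torque formula
     applies. *)
  apply: (@scalerI _ _ (m * g * enorm rho)).
    by rewrite gt_eqF// !mulr_gt0// enorm_gt0.
  rewrite scaler0 -scalerA -crossZl enorm_hanging// restoring_torque Sx.
  by rewrite mulmx0 oppr0.
apply: oppr_inj; rewrite oppr0 -(cross_hangingK rho_neq0) ?dot_cross//.
by rewrite GG linear0r.
Qed.

Lemma hanging_is_diff :
  is_diff z0 F (fun d => (cross G d.2, invmx J *m ((m * g) *: cross rho d.1))).
Proof.
apply: (is_diff_eq (is_diff_reduced_field J m g rho z0)).
apply/funext => d /=; congr pair;
  by rewrite ?(mulmx0, linear0l, linear0r, add0r, addr0).
Qed.

Lemma diff_perturbation x v :
  'd F z0 (perturbation M rho x v) = (cross G (N *m v), - (N *m stiffness x)).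
Proof.
have [_ ->] := hanging_is_diff.
by rewrite perturbationE /= invJ_restoring_torque.
Qed.

Lemma perturbation_tangent x v : reduced_tangent z0 (perturbation M rho x v).
Proof. by rewrite perturbationE /reduced_tangent/= dot_cross. Qed.

(** Only the angular velocity component carries information, and there the invertible [N] cancels.
    The gravity component holds automatically, being the derivative of a fixed linear map applied to
    [x]. *)
Lemma linearized_perturbationP (I : set R) (x : R -> 'cV[R]_3) :
  twice_derivable_on I x ->
  linearized_solution F z0 I
    (fun t => perturbation M rho (x t) (derive1 x t)) <->
  (forall t, I t -> derive1 (derive1 x) t = - stiffness (x t)).
Proof.
move=> x2; split=> [sol t It|eqn t It].
  have [_ /is_derive1_pairP[_]] := sol t It.
  have [_ /derivableP/(is_derive1_mulmx N)] := x2 t It.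
  rewrite diff_perturbation /= -derive1E.
  move=> /is_derive1_uniq/[apply]; rewrite -mulmxN.
  exact/can_inj/mulKVmx.
split; first exact: perturbation_tangent.
have [/derivableP dx /derivableP ddx] := x2 t It.
rewrite -derive1E in dx; rewrite -derive1E eqn// in ddx.
rewrite diff_perturbation -mulmxN; apply/is_derive1_pairP; split=> /=.
  by rewrite -hat_mul mulmxA; exact: is_derive1_mulmx.
exact: is_derive1_mulmx.
Qed.

Lemma cross_hanging_eq x v : cross G (N *m x) = cross G (N *m v) <->
  x 0 0 = v 0 0 /\ x 1 0 = v 1 0.
Proof.
have -> : cross G (N *m x) = cross G (N *m v) <-> cross G (N *m (x - v)) = 0.
  by rewrite mulmxBr crossBr; split=> [->|/subr0_eq//]; rewrite subrr.
rewrite cross_hanging_eq0 !mxE.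
by split=> [[/subr0_eq ? /subr0_eq ?]|[-> ->]]; rewrite ?subrr.
Qed.

(** The third coordinate of [x] is set to 0, an arbitrary choice since the perturbation does not
    depend on it. *)
Let coord_perturbation (u : 'rV[R]_5) : state R :=
  perturbation M rho (col3 (u 0 0) (u 0 1) 0)
    (col3 (u 0 2%R) (u 0 3%R) (u 0 4%R)).

Let linear_coord_perturbation : linear coord_perturbation.
Proof.
move=> k u v; rewrite /coord_perturbation.
have -> : col3 ((k *: u + v) 0 0) ((k *: u + v) 0 1) 0 =
    k *: col3 (u 0 0) (u 0 1) 0 + col3 (v 0 0) (v 0 1) 0.
  by apply/cV3P; rewrite !mxE /= mulr0 addr0.
have -> : col3 ((k *: u + v) 0 2%R) ((k *: u + v) 0 3%R) ((k *: u + v) 0 4%R) =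
    k *: col3 (u 0 2%R) (u 0 3%R) (u 0 4%R) +
    col3 (v 0 2%R) (v 0 3%R) (v 0 4%R).
  by apply/cV3P; rewrite !mxE /=.
by congr pair; rewrite /= mulmxDr scalemxAr.
Qed.

Lemma perturbation_coordinates :
  exists Phi : {linear 'rV[R]_5 -> state R},
    set_bij setT (reduced_tangent z0) Phi /\
    forall x v, Phi (reduced_coord x v) = perturbation M rho x v.
Proof.
pose fM := GRing.isLinear.Build _ _ _ _ _ linear_coord_perturbation.
pose Phi : {linear 'rV[R]_5 -> state R} := HB.pack coord_perturbation fM.
have PhiE x v : Phi (reduced_coord x v) = perturbation M rho x v.
  rewrite /Phi /= /coord_perturbation !perturbationE; congr pair.
    by apply/cross_hanging_eq; rewrite !mxE.
  by congr (_ *m _); apply/cV3P; rewrite !mxE.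
exists Phi; split => //; split.
- by move=> u _; exact: perturbation_tangent.
- have inj0 u : Phi u = 0 -> u = 0.
    rewrite /Phi /= /coord_perturbation perturbationE.
    move=> -[/cross_hanging_eq0[]]; rewrite !mxE /=.
    move=> u0 u1 /(congr1 (mulmx M^T)).
    rewrite mulKVmx// mulmx0 => /cV3P; rewrite !mxE /= => -[u2 u3 u4].
    apply/rowP => -[[|[|[|[|[|//]]]]] i]; rewrite mxE.
    - by rewrite -u0; congr (u _ _); exact: val_inj.
    - by rewrite -u1; congr (u _ _); exact: val_inj.
    - by rewrite -u2; congr (u _ _); exact: val_inj.
    - by rewrite -u3; congr (u _ _); exact: val_inj.
    - by rewrite -u4; congr (u _ _); exact: val_inj.
  move=> u v _ _ uv; apply/subr0_eq/inj0.
  by rewrite linearB uv subrr.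
- move=> [dG dw] /= dG0.
  (* The sign comes from the quarter turn: crossing twice with [G] negates the tangent vector
     [dG]. *)
  exists (reduced_coord (- (M^T *m cross G dG)) (M^T *m dw)) => //.
  apply: etrans (PhiE _ _) _; rewrite perturbationE mulmxN !mulKmx//.
  by rewrite crossNr cross_hangingK// opprK.
Qed.

(** Inverting the change of variables gives a position [w] and a velocity [v], but the derivative of
    [w] need only match [v] in its first two coordinates. The third coordinate of [w] is invisible
    in [delta], so it may be replaced by a primitive of that of [v]. *)
Lemma linearized_solution_perturbation (I : set R) (delta : R -> state R) :
  open I -> is_interval I -> linearized_solution F z0 I delta ->
  exists x : R -> 'cV[R]_3, twice_derivable_on I x /\
    forall t, I t -> delta t = perturbation M rho (x t) (derive1 x t).
Proof.
move=> oI itvI sol.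
(* The constant velocity below is read off at a point of [I], so the empty set is treated apart. *)
have [->|/set0P[t0 It0]] := eqVneq I set0; first by exists (fun=> 0).
pose w t := - (M^T *m cross G (delta t).1).
pose v t := M^T *m (delta t).2.
have deltaE t : I t -> delta t = perturbation M rho (w t) (v t).
  move=> /sol[tan _]; rewrite perturbationE mulmxN !mulKmx// crossNr.
  by rewrite cross_hangingK// opprK -surjective_pairing.
have dw t : I t ->
    is_derive t (1 : R) w (- (M^T *m cross G (cross G (N *m v t)))).
  move=> It; have [_] := sol t It; rewrite deltaE// diff_perturbation.
  move=> /is_derive1_pairP[/= d1 _]; apply: is_deriveN.
  exact/is_derive1_mulmx/is_derive1_cross.
have dv t : I t -> is_derive t (1 : R) v (- stiffness (w t)).
  move=> It; have [_] := sol t It; rewrite deltaE// diff_perturbation.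
  move=> /is_derive1_pairP[/= _ /(is_derive1_mulmx M^T)].
  by rewrite mulmxN mulKVmx.
(* The third entry of the stiffness term is 0. *)
have [c v2] : exists c, forall t, I t -> v t 2%R 0 = c.
  exists (v t0 2%R 0) => t It.
  apply: (@derive0_interval_cst _ I (fun s => v s 2%R 0)) => // s Is.
  have lc : linear (fun u : 'cV[R]_3 => u 2%R 0) by move=> k a b; rewrite !mxE.
  have := is_derive1_linear lc (linear_mx_continuous lc) (dv s Is).
  by rewrite !mxE /= oppr0.
(* [P] discards the third coordinate of [w]; the drift [t *: e] supplies the new one, with
   derivative [c]. *)
pose P (u : 'cV[R]_3) : 'cV[R]_3 := col3 (u 0 0) (u 1 0) 0.
have lP : linear P.
  by move=> k a b; apply/cV3P; rewrite !mxE /= mulr0 addr0.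
pose e : 'cV[R]_3 := col3 0 0 c.
pose x t := P (w t) + t *: e.
have dx t : I t -> is_derive t (1 : R) x (v t).
  move=> It.
  have -> : v t = P (- (M^T *m cross G (cross G (N *m v t)))) + 1 *: e.
    (* [w'] is the derivative of [w]. It has the same image as [v t] under the cross product with
       [G] after [N], hence the same first two coordinates. *)
    set w' := - _.
    have /cross_hanging_eq[e0 e1] : cross G (N *m w') = cross G (N *m v t).
      rewrite /w' mulmxN mulKmx// crossNr cross_hangingK ?opprK//.
      exact: dot_cross.
    move: w' (v t) e0 e1 (v2 t It) => {}w' vt e0 e1 e2.
    by apply/cV3P; rewrite !mxE /= e0 e1 e2 !mulr0 mul1r !addr0 add0r.
  apply: is_deriveD.
    exact: is_derive1_linear lP (linear_mx_continuous lP) (dw t It).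
  have le : linear (fun s : R => s *: e).
    by move=> k a b; rewrite scalerDl scalerA.
  apply: (is_derive1_linear le _ (is_derive_id t 1)).
  exact: scalel_continuous.
have dxE t : I t -> derive1 x t = v t by move=> /dx[_]; rewrite derive1E.
exists x; split=> [t It|t It].
  split; first by have [] := dx t It.
  (* The derivative of [x] is known to equal [v] only on [I]; openness of [I] makes the two agree
     near [t], which transfers derivability. *)
  have [+ _] := dv t It; apply: near_eq_derivable.
  near=> s; apply/esym/dxE; near: s; exact: open_nbhs_nbhs.
rewrite dxE// deltaE// !perturbationE; congr pair.
apply/cross_hanging_eq; rewrite /x; move: (w t) => wt.
by rewrite !mxE /= !mulr0 !addr0.
Unshelve. all: by end_near. Qed.

End Pendulum.

Unset Implicit Arguments.

Theorem proposition11 (R : realType) (J M : 'M[R]_3) (m g l1 l2 : R)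
    (rho : 'cV[R]_3)
    (J_posdef : sym_posdef J)
    (m_gt0 : 0 < m) (g_gt0 : 0 < g) (rho_neq0 : rho != 0)
    (l1_gt0 : 0 < l1) (l2_gt0 : 0 < l2)
    (M_unit : M \in unitmx)
    (J_diag : J = M *m M^T)
    (rho_diag : - (m * g / enorm rho) *: (hat rho *m hat rho) =
      M *m diag_mx (col3 (m * g * l1) (m * g * l2) 0)^T *m M^T) :
  let F := reduced_field J m g rho in
  let z0 := hanging_equilibrium rho in
  [/\ (* the linearization at the hanging equilibrium is well defined *)
      [/\ reduced_space z0, F z0 = 0, differentiable F z0 &
        forall d, reduced_tangent z0 d -> reduced_tangent z0 ('d F z0 d)],
      (* (x1, x2, v1, v2, v3) are linear coordinates on the tangent space *)
      exists Phi : {linear 'rV[R]_5 -> state R},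
        set_bij setT (reduced_tangent z0) Phi /\
        forall x v : 'cV[R]_3,
          Phi (reduced_coord x v) = perturbation M rho x v,
      (* in which the linearized equations are the stated ones *)
      forall (I : set R) (x : R -> 'cV[R]_3), open I -> is_interval I ->
        twice_derivable_on I x ->
        linearized_solution F z0 I
          (fun t => perturbation M rho (x t) (derive1 x t)) <->
        (forall t, I t ->
          [/\ derive1 (derive1 x) t 0 0 + m * g * l1 * x t 0 0 = 0,
              derive1 (derive1 x) t 1 0 + m * g * l2 * x t 1 0 = 0 &
              derive1 (derive1 x) t 2%R 0 = 0]) &
      (* and every solution of the linearization is so expressed *)
      forall (I : set R) (delta : R -> state R), open I -> is_interval I ->
        linearized_solution F z0 I delta ->
        exists x : R -> 'cV[R]_3, twice_derivable_on I x /\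
          forall t, I t -> delta t = perturbation M rho (x t) (derive1 x t)].
Proof.
move=> F z0; split.
(* Kept in context as an instance: it settles differentiability and lets [diff_val] compute the
   differential, whose first component is a cross product with [G] and so tangent. *)
- have Fd := hanging_is_diff J m g rho; split.
  + by rewrite /reduced_space /= /enorm dot_hanging// sqrtr1.
  + have rr : cross rho rho = 0 by apply/cV3P; rewrite !mxE /=; split; ring.
    congr pair => /=; first exact: linear0r.
    by rewrite linear0r add0r crossZr rr !scaler0 mulmx0.
  + by [].
  + by move=> d _; rewrite /reduced_tangent diff_val /= dot_cross.
- exact: (perturbation_coordinates m_gt0 g_gt0 _ l1_gt0 l2_gt0 _ rho_diag).
- move=> I x _ _ x2.
  apply: (iff_trans (linearized_perturbationP M_unit J_diag rho_diag x2)).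
  split=> eqn t It; have := eqn t It.
    by move=> ->; rewrite !mxE /= oppr0 !addNr.
  move=> [/eqP + /eqP + e2]; rewrite !addr_eq0 => /eqP e0 /eqP e1.
  by apply/cV3P; rewrite e0 e1 e2 !mxE /= oppr0.
- by move=> I delta; exact: (linearized_solution_perturbation m_gt0 g_gt0 _
    l1_gt0 l2_gt0 _ J_diag rho_diag).
Qed.
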